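(* Let $M$ be a matroid with cycle system $\mathcal{C}=\{C_1,\dots,C_g\}$, $g=g(M)$. Then the poset of coparking functions $P^*(\mathcal{C})$ is a pure multicomplex. An element $a\in P^*(\mathcal{C})$ is maximal if and only if $\deg(a)=r(M)-\beta$, where $\beta$ is the number of bridges of $M$.
   Context: Matroids are on finite ground sets; $r(M)$ is the rank and $g(M)=|E(M)|-r(M)$ the corank. $\mathbb{N}$ includes $0$, and $\mathbb{N}^0=\{()\}$. A *cycle* of $M$ is a union of circuits; a *bridge* is a coloop. Unique union: for a family $\mathcal{A}=\{A_1,\dots,A_g\}$ of subsets of a set and $\sigma\subseteq[g]=\{1,\dots,g\}$, $\mathcal{A}_\sigma$ is the set of elements $e\in\bigcup_{i\in\sigma}A_i$ for which there is exactly one $i\in\sigma$ with $e\in A_i$. A *cycle system* for $M$ is a collection $\mathcal{C}=\{C_1,\dots,C_g\}$ of cycles of $M$ with $g=g(M)$ such that for every nonempty $\sigma\subseteq[g]$ the unique union $\mathcal{C}_\sigma$ is dependent in $M$. A *coparking function* with respect to $\mathcal{C}$ is a vector $a=(a_1,\dots,a_g)\in\mathbb{N}^g$ such that for every nonempty $\sigma\subseteq[g]$ there is some $i\in\sigma$ with $a_i<|C_i\cap\mathcal{C}_\sigma|$ (if $g=0$, the only one is $()$). $P^*(\mathcal{C})$ is the set of coparking functions, ordered componentwise; $\deg(a)=\sum_i a_i$, with $\deg(())=0$. A *multicomplex* is (identified with) a finite order ideal of $\mathbb{N}^g$, i.e. a finite subset closed under passing to componentwise smaller vectors; it is *pure*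 if all its maximal elements have the same degree. *)

(* Defs.v *)
From mathcomp Require Import all_boot.

Set Implicit Arguments.
Unset Strict Implicit.
Unset Printing Implicit Defensive.

Record matroid (T : finType) := Matroid {
  indep : {pred {set T}};
  indep0 : set0 \in indep;
  indep_sub : forall I J : {set T},
    J \in indep -> I \subset J -> I \in indep;
  indep_aug : forall I J : {set T},
    I \in indep -> J \in indep -> #|I| < #|J| ->
    exists2 x, x \in J :\: I & x |: I \in indep
}.

Section MatroidNotions.
Variables (T : finType) (M : matroid T).
Implicit Types (B C X : {set T}) (e : T).

Definition dependent X : bool := X \notin indep M.

Definition basis B : bool := maxset [pred X | X \in indep M] B.

Definition rank : nat := \max_(X in indep M) #|X|.

Definition corank : nat := #|T| - rank.

Definition circuit C : bool := minset dependent C.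

Definition is_cycle C : bool :=
  [exists S : {set {set T}}, (S \subset circuit) && (C == cover S)].

Definition bridge e : bool := [forall (B : {set T} | basis B), e \in B].

Definition num_bridges : nat := #|[set e | bridge e]|.

(* Hence [rank - num_bridges] is a true (untruncated) difference. *)
Lemma num_bridges_le_rank : num_bridges <= rank.
Proof.
have [B Bmax _] := @maxset_exists _ [pred X | X \in indep M] set0 (indep0 M).
have BI : B \in indep M by case/maxsetP: Bmax.
apply: (@leq_trans #|B|); last exact: (@bigmax_sup _ B).
apply/subset_leq_card/subsetP=> e; rewrite inE => /forall_inP; exact.
Qed.

End MatroidNotions.

Section CycleSystems.
Variables (T : finType).

Definition unique_union g (A : 'I_g -> {set T}) (s : {set 'I_g}) : {set T} :=
  [set e | #|[set i in s | e \in A i]| == 1].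

Definition cycle_system (M : matroid T) (C : 'I_(corank M) -> {set T}) : Prop :=
  (forall i, is_cycle M (C i)) /\
  (forall s : {set 'I_(corank M)}, s != set0 -> dependent M (unique_union C s)).

Definition coparking g (C : 'I_g -> {set T}) : {pred {ffun 'I_g -> nat}} :=
  [pred a : {ffun 'I_g -> nat} |
    [forall (s : {set 'I_g} | s != set0),
      exists i in s, a i < #|C i :&: unique_union C s|]].

End CycleSystems.

Section Multicomplexes.
Variable g : nat.
Implicit Types (a b : {ffun 'I_g -> nat}) (P : {pred {ffun 'I_g -> nat}}).

Definition le_vec a b : bool := [forall i, a i <= b i].

Definition deg a : nat := \sum_(i < g) a i.

Definition maximal_in P a : Prop :=
  a \in P /\ (forall b, b \in P -> le_vec a b -> b = a).

Definition multicomplex P : Prop :=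
  (exists s : seq {ffun 'I_g -> nat}, {subset P <= s}) /\
  (forall a b, b \in P -> le_vec a b -> a \in P).

Definition pure P : Prop :=
  forall a b, maximal_in P a -> maximal_in P b -> deg a = deg b.

End Multicomplexes.

(* Main.v *)
(** Dhar's burning algorithm, run on a coparking function [a], orders the indices so that each [a i]
    is less than the number of elements of [C i] missing from all later [C j]. Raising every
    [a i] to that number minus one keeps [a] coparking, and as these parts of the [C i] are disjoint
    with union [\bigcup_i C i], the raised function has degree [#|\bigcup_i C i| - g]. So every
    coparking function lies below one of that degree. It remains to see that
    [\bigcup_i C i] is the set of non-bridges. Cycles avoid bridges. Conversely, [k] sets
    whose unique unions are all dependent can only lie inside a set of nullity at least [k]: delete a
    redundant element of the total unique union, which destroys just one of the sets, and induct.
    Deleting a non-bridge lowers the corank, hence must destroy one of the [C i]. *)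
Require Import Defs.
From mathcomp Require Import all_boot.

Set Implicit Arguments.
Unset Strict Implicit.
Unset Printing Implicit Defensive.

Section Matroid.
Variables (T : finType) (M : matroid T).
Implicit Types (I J B D X : {set T}) (e : T).

(** Take [K] maximal among the independent sets between [I] and [I :|: J]; were it smaller than [J],
    augmentation would enlarge it. *)
Lemma indep_extend I J : I \in indep M -> J \in indep M ->
  exists2 K, K \in indep M & [/\ I \subset K, K \subset I :|: J & #|J| <= #|K|].
Proof.
move=> II JI.
pose P K := [&& K \in indep M, I \subset K & K \subset I :|: J].
have PI : P I by rewrite /P II subxx subsetUl.
have [K /maxsetP[/and3P[KI IK KJ] Kmax] _] := maxset_exists PI.
exists K => //; split=> //; rewrite leqNgt; apply/negP=> ltKJ.
have [x /setDP[xJ xK] xKI] := indep_aug KI JI ltKJ.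
have eqK : x |: K = K.
  apply: Kmax; last exact: subsetUr.
  by rewrite /P xKI (subset_trans IK (subsetUr _ _)) subUset sub1set inE xJ orbT.
by rewrite -eqK setU11 in xK.
Qed.

Lemma indep_card_le_rank I : I \in indep M -> #|I| <= rank M.
Proof. by move=> II; apply: (bigmax_sup I). Qed.

Lemma rank_le_card : rank M <= #|T|.
Proof. by apply/bigmax_leqP=> I _; apply: max_card. Qed.

Lemma rank_indepP : exists2 I, I \in indep M & #|I| = rank M.
Proof.
have [|I II eqI] := @eq_bigmax_cond _ (indep M) (fun I => #|I|).
  by apply/card_gt0P; exists set0; apply: indep0.
by exists I; rewrite // -eqI.
Qed.

Lemma indep_sub_basis I : I \in indep M ->
  exists2 B, basis M B & I \subset B.
Proof. by move=> /(@maxset_exists _ [pred X in indep M])[B]; exists B. Qed.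

Lemma basisP B : basis M B -> B \in indep M /\ #|B| = rank M.
Proof.
case/maxsetP=> /= BI Bmax; split=> //; apply/eqP.
rewrite eqn_leq indep_card_le_rank //=.
have [I II <-] := rank_indepP.
by have [K KI [BK _]] := indep_extend BI II; rewrite (Bmax K KI BK).
Qed.

(** By minimality [D :\ e] is independent, so it lies in a basis; that basis also contains the
    bridge [e], hence all of [D]. *)
Lemma bridge_notin_circuit D e : circuit M D -> bridge M e -> e \notin D.
Proof.
case/minsetP=> Ddep Dmin /forall_inP bre; apply/negP=> eD.
have DeI : D :\ e \in indep M.
  apply/negPn/negP=> /Dmin; rewrite subD1set => /(_ isT) eqD.
  by move: eD; rewrite -eqD setD11.
have [B Bb DB] := indep_sub_basis DeI.
case/negP: Ddep; apply: indep_sub (basisP Bb).1 _.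
by rewrite -(setD1K eD) subUset sub1set bre.
Qed.

Lemma bridge_notin_cycle D e : is_cycle M D -> bridge M e -> e \notin D.
Proof.
case/existsP=> S /andP[/subsetP Scirc /eqP->] bre.
by apply/bigcupP=> -[F /Scirc Fc]; apply/negP/bridge_notin_circuit.
Qed.

(** Letting [I] range over all independent subsets of [X] expresses the nullity bound without a rank
    function on subsets. *)
Lemma unique_union_nullity g (A : 'I_g -> {set T}) :
  (forall s : {set 'I_g}, s != set0 -> dependent M (unique_union A s)) ->
  forall (s : {set 'I_g}) X I, \bigcup_(i in s) A i \subset X ->
  I \in indep M -> I \subset X -> #|I| + #|s| <= #|X|.
Proof.
move=> Adep s X I; move cs: #|s| => n.
elim: n s cs X I => [|n IHn] s cs X I sX II IX.
  by rewrite addn0 subset_leq_card.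
have s0 : s != set0 by rewrite -card_gt0 cs.
pose P K := (K \in indep M) && (K \subset unique_union A s).
have P0 : P set0 by rewrite /P indep0 sub0set.
have [K /maxsetP[/andP[KI Ks] Kmax] _] := maxset_exists P0.
have /subsetPn[e es eK] : ~~ (unique_union A s \subset K).
  by apply/negP=> sK; case/negP: (Adep s s0); apply: indep_sub KI sK.
(* [I] may contain [e], so it is traded for a set at least as large that extends [K]; maximality of
   [K] keeps [e] out of it. *)
have [J JI [KJ JKI leIJ]] := indep_extend KI II.
have eJ : e \notin J.
  apply/negP=> eJ; case/negP: eK; rewrite -(Kmax (e |: K)) ?setU11 ?subsetUr //.
  rewrite /P subUset sub1set es Ks !andbT.
  by apply: indep_sub JI _; rewrite subUset sub1set eJ.
have [i si] : exists i, [set i in s | e \in A i] = [set i].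
  by apply/cards1P; move: es; rewrite inE.
have /setIdP[is_ eAi] : i \in [set i in s | e \in A i] by rewrite si set11.
have UX : unique_union A s \subset X.
  apply/(subset_trans _ sX)/subsetP=> x; rewrite inE => /cards1P[j sj].
  have /setIdP[js xj] : j \in [set j in s | x \in A j] by rewrite sj set11.
  by apply/bigcupP; exists j.
have eX : e \in X by apply: (subsetP UX).
have JX : J \subset X :\ e.
  rewrite subsetD1 eJ andbT (subset_trans JKI) // subUset IX andbT.
  exact: subset_trans Ks UX.
have csi : #|s :\ i| = n by move: cs; rewrite (cardsD1 i) is_ => -[].
have siX : \bigcup_(j in s :\ i) A j \subset X :\ e.
  apply/bigcupsP=> j /setD1P[ji js]; rewrite subsetD1; apply/andP; split.
    by apply: subset_trans sX; apply: bigcup_sup.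
  apply/negP=> eAj; have : j \in [set i in s | e \in A i] by rewrite inE js.
  by rewrite si inE (negPf ji).
have := IHn _ csi _ _ siX JI JX.
rewrite [#|X|](cardsD1 e) eX addnS ltnS.
by apply: leq_trans; rewrite leq_add2r.
Qed.

Lemma cover_cycle_system (C : 'I_(corank M) -> {set T}) : cycle_system C ->
  \bigcup_i C i = [set e | ~~ bridge M e].
Proof.
case=> Ccyc Cdep; apply/setP=> e; rewrite inE; apply/idP/idP.
  case/bigcupP=> i _ eC; apply/negP=> bre.
  by move: eC; apply/negP/(bridge_notin_cycle (Ccyc i)).
apply: contraR => eC; apply/forall_inP=> B /basisP[BI cB].
apply/negPn/negP=> eB.
have sX : \bigcup_(i in setT) C i \subset ~: [set e].
  by under eq_bigl do rewrite inE; rewrite subsetC sub1set inE.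
have BX : B \subset ~: [set e] by rewrite subsetC sub1set inE.
(* Rank plus corank is [#|T|], whereas [X] has only [#|T|.-1] elements. *)
have := unique_union_nullity Cdep sX BI BX.
rewrite cB cardsT card_ord subnKC ?rank_le_card // cardsC1.
by rewrite leqNgt prednK ?leqnn //; apply/card_gt0P; exists e.
Qed.

End Matroid.

Section Coparking.
Variables (T : finType) (g : nat) (A : 'I_g -> {set T}).
Implicit Types (s t : {set 'I_g}) (a b : {ffun 'I_g -> nat}).

Lemma unique_unionD1 s i : i \in s ->
  A i :&: unique_union A s = A i :\: \bigcup_(j in s :\ i) A j.
Proof.
move=> is_; apply/setP=> e; rewrite in_setI in_setD andbC.
case: (boolP (e \in A i)) => eA; rewrite ?andbF // !andbT.
rewrite inE (cardsD1 i) inE is_ eA eqSS cards_eq0.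
apply/eqP/idP=> [s0|/bigcupP eA'].
  apply/bigcupP=> -[j /setD1P[ji js] ej]; have := in_set0 j.
  by rewrite -s0 !inE ji js ej.
apply/setP=> j; rewrite !inE; apply/negP=> /and3P[ji js ej]; case: eA'.
by exists j; rewrite // !inE ji.
Qed.

(** With fewer competing indices, more of [A i] is covered by [A i] alone. *)
Lemma unique_unionS s t i : i \in t -> t \subset s ->
  A i :&: unique_union A s \subset A i :&: unique_union A t.
Proof.
move=> it ts; rewrite !unique_unionD1 ?(subsetP ts) //.
apply/setDS/bigcupsP=> j jt; apply: bigcup_sup.
exact: subsetP (setSD _ ts) _ jt.
Qed.

Lemma coparkingP a :
  reflect (forall s, s != set0 ->
             exists2 i, i \in s & a i < #|A i :&: unique_union A s|)
          (a \in coparking A).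
Proof.
by apply: (iffP forall_inP) => aP s /aP /exists_inP.
Qed.

Lemma coparking_raise a : a \in coparking A ->
  exists2 b, b \in coparking A &
    le_vec a b /\ deg b + g = #|\bigcup_i A i|.
Proof.
move=> /coparkingP aP.
(* Relativized to an index set [s] for induction on [#|s|]: the index burnt first is removed, and
   the rest is raised within [s :\ i]. *)
suff burn s : exists b, [/\ {in s, forall i, a i <= b i},
    forall t, t != set0 -> t \subset s ->
      exists2 i, i \in t & b i < #|A i :&: unique_union A t| &
    \sum_(i in s) (b i).+1 = #|\bigcup_(i in s) A i|].
  have [b [ab bP bdeg]] := burn setT; exists b.
    by apply/coparkingP=> s s0; apply: bP.
  split; first by apply/forallP=> i; apply: ab.
  have inT : (fun i : 'I_g => i \in [set: 'I_g]) =1 xpredT.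
    by move=> i; rewrite inE.
  move: bdeg; rewrite !(eq_bigl _ _ inT) => <-.
  rewrite (eq_bigr (fun i => b i + 1)) => [|i _]; last by rewrite addn1.
  by rewrite big_split /= sum1_card card_ord.
move cs: #|s| => n; elim: n s cs => [|n IHn] s cs.
  move/eqP: cs; rewrite cards_eq0 => /eqP->; exists a; split=> //.
    by move=> t t0; rewrite subset0 (negPf t0).
  by rewrite !big_set0 cards0.
have s0 : s != set0 by rewrite -card_gt0 cs.
have [i is_ ai] := aP s s0.
have [|b [ab bP bdeg]] := IHn (s :\ i).
  by move: cs; rewrite (cardsD1 i) is_ => -[].
pose d := #|A i :&: unique_union A s|.
have d0 : 0 < d by apply: leq_ltn_trans ai.
exists [ffun j => if j == i then d.-1 else b j]; split.
- move=> j js; rewrite ffunE; case: eqVneq => [->|ji].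
    by rewrite -ltnS prednK.
  by apply: ab; rewrite !inE ji.
(* If [t] contains [i], then [i] is a witness by monotonicity; otherwise [t] lies in [s :\ i], where
   the values are those of [b]. *)
- move=> t t0 ts; case: (boolP (i \in t)) => it.
    exists i; rewrite // ffunE eqxx prednK //.
    exact/subset_leq_card/unique_unionS.
  have [|j jt bj] := bP t t0; first by rewrite subsetD1 ts.
  exists j; rewrite // ffunE ifN //.
  by apply: contraNneq it => <-.
(* The new term is [d], exactly the number of elements that [A i] adds to the union of the
   others. *)
- rewrite (big_setD1 i) //= ffunE eqxx prednK // [in RHS](big_setD1 i) //=.
  rewrite (eq_bigr (fun j => (b j).+1)); last first.
    by move=> j /setD1P[ji _]; rewrite ffunE ifN.
  rewrite bdeg /d unique_unionD1 // cardsU cardsD.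
  by rewrite addnBAC ?subset_leq_card ?subsetIl.
Qed.

Lemma coparking_deg a : a \in coparking A -> deg a + g <= #|\bigcup_i A i|.
Proof.
case/coparking_raise=> b _ [/forallP ab <-].
by rewrite leq_add2r; apply: leq_sum => i _; apply: ab.
Qed.

Lemma le_vec_deg_eq a b : le_vec a b -> deg b <= deg a -> b = a.
Proof.
move=> /forallP ab dba; apply/ffunP=> i; apply/eqP; rewrite eq_sym.
have [_ eqD] := leqif_sum (fun i (_ : true) => leqif_eq (ab i)).
have : deg a == deg b by rewrite eqn_leq dba andbT; apply: leq_sum.
by rewrite eqD => /forall_inP; apply.
Qed.

(** A maximal function equals its raising, which has top degree; conversely, nothing strictly above
    a function of top degree is coparking. *)
Lemma maximal_coparking a : a \in coparking A ->
  maximal_in (coparking A) a <-> deg a + g = #|\bigcup_i A i|.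
Proof.
move=> aP; split=> [[_ amax]|dega].
  by have [b bP [ab <-]] := coparking_raise aP; rewrite (amax b bP ab).
split=> // b bP ab; apply: le_vec_deg_eq ab _.
by rewrite -(leq_add2r g) dega coparking_deg.
Qed.

Lemma multicomplex_coparking : multicomplex (coparking A).
Proof.
split.
  exists [seq [ffun i => val (f i)] | f : {ffun 'I_g -> 'I_#|T|.+1}] => a.
  move=> /coparkingP aP; apply/imageP.
  have aT i : a i < #|T|.+1.
    (* Singletons bound every coordinate, which gives finiteness. *)
    have [|j /set1P-> aj] := aP [set i].
      by apply/set0Pn; exists i; rewrite set11.
    by rewrite ltnS (leq_trans (ltnW aj)) ?max_card.
  exists [ffun i => Ordinal (aT i)] => //.
  by apply/ffunP=> i; rewrite !ffunE.
move=> a b /coparkingP bP /forallP ab; apply/coparkingP=> s /bP[i is_ bi].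
by exists i; rewrite // (leq_ltn_trans (ab i)).
Qed.

End Coparking.

Theorem proposition4p3 (T : finType) (M : matroid T)
    (C : 'I_(corank M) -> {set T}) (hC : cycle_system C) :
  (multicomplex (coparking C) /\ pure (coparking C)) /\
  (forall a : {ffun 'I_(corank M) -> nat}, a \in coparking C ->
     (maximal_in (coparking C) a <-> deg a = rank M - num_bridges M)).
Proof.
(* Both sides are [#|T|] minus the number of bridges; cancelling [corank M] then gives the
   degree. *)
have cC : #|\bigcup_i C i| = rank M - num_bridges M + corank M.
  rewrite (cover_cycle_system hC) addnC addnBA ?num_bridges_le_rank //.
  rewrite /corank subnK ?rank_le_card // -(cardsC [set e | bridge M e]) addKn.
  by congr #|pred_of_set _|; apply/setP=> e; rewrite !inE.
have maxP a : a \in coparking C ->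
    (maximal_in (coparking C) a <-> deg a = rank M - num_bridges M).
  move=> /maximal_coparking[]; rewrite cC => to_deg of_deg.
  by split=> [/to_deg/addIn|dega]; last by apply: of_deg; rewrite dega.
split=> //; split; first exact: multicomplex_coparking.
by move=> a b amax bmax; rewrite (maxP a amax.1).1 ?(maxP b bmax.1).1.
Qed.
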